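(* Let $D\in\mathbb{R}^{m\times n}$, let $S\in\mathcal{S}(D)$ be arbitrary and let $x,t>0$. Choose $\lambda\ge \gamma\sigma\sqrt{2\log(2(n-r_S))/n+2t/n}$. Then for the analysis estimator $\hat f$ with tuning parameter $\lambda$ it holds that, for all $f\in\mathbb{R}^n$, with probability at least $1-e^{-x}-e^{-t}$, $$\|\hat f-f^0\|_n^2+2\lambda\|D_S\hat f\|_1\le \|f-f^0\|_n^2+\frac{\sigma^2}{n}\left(\sqrt{2x}+\sqrt{r_S}\right)^2+4\lambda\|Df\|_1 .$$
   Context: Model: $f^0\in\mathbb{R}^n$ is a fixed signal and one observes $Y=f^0+\epsilon$ with $\epsilon\sim\mathcal{N}_n(0,\sigma^2 \mathrm{I}_n)$, $\sigma\in(0,\infty)$. For $f\in\mathbb{R}^n$, $\|f\|_n^2=\sum_{i=1}^n f_i^2/n$. The analysis estimator is $\hat f=\arg\min_{f\in\mathbb{R}^n}\{\|Y-f\|_n^2+2\lambda\|Df\|_1\}$, $\lambda>0$. Active sets: $[m]=\{1,\dots,m\}$; $d_i'$ is the $i$-th row of $D$. For $S\subseteq[m]$, $-S=[m]\setminus S$, $s=|S|$, and $D_S$, $D_{-S}$ are the submatrices of $D$ with rows indexed by $S$, $-S$. Put $S(f)=\{j\in[m]: d_j'f\neq0\}$ and $\mathcal{S}(D)=\{S\subseteq[m]:\exists f\in\mathbb{R}^n,\ S=S(f)\}$. $r_S=\dim \mathcal{N}(D_{-S})$, the dimension of the nullspace of $D_{-S}$. Scaling factor: let $D_{-S}^+\in\mathbb{R}^{n\times(m-s)}$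 be the Moore–Penrose pseudoinverse of $D_{-S}$, with columns $d_1^+,\dots,d_{m-s}^+$. Then $\gamma=\max_{i\in[m-s]}\|d_i^+\|_n$. *)

(* Defs.v *)
From HB Require Import structures.
From mathcomp Require Import all_boot all_order all_algebra.
From mathcomp Require Import all_classical all_reals all_analysis.

Set Implicit Arguments.
Unset Strict Implicit.
Unset Printing Implicit Defensive.

Import Order.TTheory GRing.Theory Num.Theory.
Import numFieldNormedType.Exports.

Local Open Scope classical_set_scope.
Local Open Scope ring_scope.

Section Norms.
Context {R : realType}.

Definition norm1 n (v : 'cV[R]_n) : R := \sum_(i < n) `|v i 0|.

Definition normn n (f : 'cV[R]_n) : R :=
  Num.sqrt ((\sum_(i < n) f i 0 ^+ 2) / n%:R).

Lemma norm1_ge0 n (v : 'cV[R]_n) : 0 <= norm1 v.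
Proof. by apply: sumr_ge0 => i _; exact: normr_ge0. Qed.

Lemma normn_ge0 n (f : 'cV[R]_n) : 0 <= normn f.
Proof. exact: sqrtr_ge0. Qed.

Lemma sqr_normn n (f : 'cV[R]_n) :
  normn f ^+ 2 = (\sum_(i < n) f i 0 ^+ 2) / n%:R.
Proof.
rewrite sqr_sqrtr// mulr_ge0 ?invr_ge0 ?ler0n//.
by apply: sumr_ge0 => i _; exact: sqr_ge0.
Qed.

End Norms.

Section PseudoInverse.
Context {R : realType}.

(* The four Penrose equations; the matrices are real, so the conjugate
   transpose is the transpose. *)
Definition moore_penrose m n (A : 'M[R]_(m, n)) (B : 'M[R]_(n, m)) : Prop :=
  [/\ A *m B *m A = A, B *m A *m B = B,
      (A *m B)^T = A *m B & (B *m A)^T = B *m A].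

Definition mpinv m n (A : 'M[R]_(m, n)) : 'M[R]_(n, m) :=
  xget 0 [set B | moore_penrose A B].

Lemma moore_penrose_unique m n (A : 'M[R]_(m, n)) (B C : 'M[R]_(n, m)) :
  moore_penrose A B -> moore_penrose A C -> B = C.
Proof.
move=> [b1 b2 b3 b4] [c1 c2 c3 c4].
have AB : A *m B = A *m C.
  rewrite -{1}c1 -(mulmxA (A *m C)) -{1}b3 -c3 -trmx_mul.
  by rewrite mulmxA b1 c3.
have BA : B *m A = C *m A.
  rewrite -{1}c1 -mulmxA mulmxA -{1}b4 -c4 -trmx_mul.
  by rewrite -(mulmxA C) (mulmxA A B) b1 c4.
by rewrite -b2 BA -mulmxA AB mulmxA c2.
Qed.

Lemma row_mul_tr_eq0 r (v : 'rV[R]_r) : v *m v^T = 0 -> v = 0.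
Proof.
move/matrixP/(_ 0 0); rewrite !mxE => /eqP; rewrite psumr_eq0; last first.
  by move=> k _; rewrite !mxE -expr2 sqr_ge0.
move=> /allP v0; apply/rowP => j; rewrite mxE; apply/eqP.
by move: (v0 j (mem_index_enum _)); rewrite !mxE -expr2 sqrf_eq0.
Qed.

Lemma gram_unit m r (C : 'M[R]_(m, r)) : row_full C -> C^T *m C \in unitmx.
Proof.
move=> fC; rewrite -row_free_unit -kermx_eq0 -submx0.
apply/row_subP => i; rewrite submx0; set u := row i _.
have : u *m (C^T *m C) = 0 by rewrite -row_mul mulmx_ker row0.
move=> /(congr1 (mulmx^~ u^T)); rewrite mul0mx mulmxA -mulmxA.
have -> : C *m u^T = (u *m C^T)^T by rewrite trmx_mul trmxK.
move/row_mul_tr_eq0 => v0.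
have fT : row_free C^T by rewrite /row_free mxrank_tr.
by apply/eqP/(row_free_inj fT); rewrite mul0mx.
Qed.

Lemma moore_penrose_factor m r n (C : 'M[R]_(m, r)) (F : 'M[R]_(r, n)) :
  row_full C -> row_free F ->
  moore_penrose (C *m F)
    (F^T *m invmx (F *m F^T) *m (invmx (C^T *m C) *m C^T)).
Proof.
move=> fC fF.
have uC : C^T *m C \in unitmx by exact: gram_unit.
have uF : F *m F^T \in unitmx.
  by rewrite -{1}(trmxK F); apply: gram_unit; rewrite /row_full mxrank_tr.
have sC : (invmx (C^T *m C))^T = invmx (C^T *m C).
  by rewrite trmx_inv trmx_mul trmxK.
have sF : (invmx (F *m F^T))^T = invmx (F *m F^T).
  by rewrite trmx_inv trmx_mul trmxK.
set G := invmx (C^T *m C) *m C^T; set H := F^T *m invmx (F *m F^T).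
have GC : G *m C = 1%:M by rewrite -mulmxA mulVmx.
have FH : F *m H = 1%:M by rewrite mulmxA mulmxV.
have AB : C *m F *m (H *m G) = C *m G by rewrite -mulmxA (mulmxA F) FH mul1mx.
have BA : H *m G *m (C *m F) = H *m F by rewrite -mulmxA (mulmxA G) GC mul1mx.
split.
- by rewrite AB -mulmxA (mulmxA G) GC mul1mx.
- by rewrite BA -mulmxA (mulmxA F) FH mul1mx.
- by rewrite AB /G !trmx_mul sC trmxK mulmxA.
- by rewrite BA /H !trmx_mul sF trmxK mulmxA.
Qed.

Lemma moore_penrose_ex m n (A : 'M[R]_(m, n)) : exists B, moore_penrose A B.
Proof.
have := moore_penrose_factor (col_base_full A) (row_base_free A).
by rewrite mulmx_base; eexists; eassumption.
Qed.

Lemma mpinvP m n (A : 'M[R]_(m, n)) : moore_penrose A (mpinv A).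
Proof.
have [B AB] := moore_penrose_ex A.
exact: (@xgetPex _ 0 [set B | moore_penrose A B] (ex_intro _ B AB)).
Qed.

End PseudoInverse.

Section Analysis.
Context {R : realType} {m n : nat}.
Variable D : 'M[R]_(m, n).

(* Rows of D indexed by S, in increasing order of the index. *)
Definition rows_in (S : {set 'I_m}) : 'M[R]_(#|S|, n) :=
  rowsub (@enum_val _ (mem S)) D.

Definition active_set (f : 'cV[R]_n) : {set 'I_m} :=
  [set j | (D *m f) j 0 != 0]%SET.

Definition is_active_set (S : {set 'I_m}) : Prop :=
  exists f : 'cV[R]_n, S = active_set f.

(* kermx computes left kernels, hence the transpose. *)
Definition nulldim (S : {set 'I_m}) : nat :=
  \rank (kermx (rows_in (~: S)%SET)^T).

(* The maximum over an empty set of columns (S = [m]) is 0. *)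
Definition scaling_factor (S : {set 'I_m}) : R :=
  \big[Num.max/0]_(i < #|(~: S)%SET|) normn (col i (mpinv (rows_in (~: S)%SET))).

Definition analysis_objective (Y : 'cV[R]_n) (lambda : R) (f : 'cV[R]_n) : R :=
  normn (Y - f) ^+ 2 + 2 * lambda * norm1 (D *m f).

(* The objective is strictly convex and coercive, so that the minimizer exists
   and is unique (for 0 <= lambda). *)
Definition is_analysis_estimator (Y : 'cV[R]_n) (lambda : R) (fhat : 'cV[R]_n)
    : Prop :=
  forall f, analysis_objective Y lambda fhat <= analysis_objective Y lambda f.

End Analysis.

Section Gaussian.
Context {R : realType} {d : measure_display} {T : measurableType d}.
Variable P : probability T R.

(* Arbitrary B i, including setT, so that the product rule holds for every
   subfamily. *)
Definition mutually_independent n (X : 'I_n -> {RV P >-> R}) : Prop :=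
  forall B : 'I_n -> set R, (forall i, measurable (B i)) ->
    P (\bigcap_(i : 'I_n) (X i @^-1` B i)) = (\prod_(i < n) P (X i @^-1` B i))%E.

(* normal_prob takes the standard deviation, not the variance. *)
Definition iid_normal n (sigma : R) (X : 'I_n -> {RV P >-> R}) : Prop :=
  mutually_independent X /\
  forall (i : 'I_n) (B : set R), measurable B ->
    distribution P (X i) B = normal_prob 0 sigma B.

Definition rvec n (X : 'I_n -> {RV P >-> R}) (w : T) : 'cV[R]_n :=
  \col_i X i w.

End Gaussian.

(* Main.v *)
Require Import Defs.
From HB Require Import structures.
From mathcomp Require Import all_boot all_order all_algebra.
From mathcomp Require Import all_classical all_reals all_analysis.
From mathcomp Require Import measurable_realfun normal_distribution.
From mathcomp Require Import ring lra.

Set Implicit Arguments.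
Unset Strict Implicit.
Unset Printing Implicit Defensive.

Import Order.TTheory GRing.Theory Num.Theory.
Import numFieldNormedType.Exports.

Local Open Scope classical_set_scope.
Local Open Scope ring_scope.

(** The proof separates a deterministic inequality from two tail bounds.

    Deterministic part.  The objective is strongly convex, so its minimizer
    beats every [f] with the margin [normn (f - fhat) ^+ 2] ([estimator_gap]).
    Expanding the squares leaves the noise term <e, fhat - f>.  Put
    [A = rows_in D (~: S)] and split e orthogonally along the kernel of A.  The
    kernel part Pi e is paid for by the margin and costs |Pi e|^2 / n.  The
    other part is <(A^+)^T e, A (fhat - f)>; the penalty on the inactive rows
    absorbs it as soon as it is at most n lambda |A (fhat - f)|_1
    ([oracle_inequality]).

    Kernel part.  For a standard Gaussian xi, |Pi xi|^2 is chi-square with r_S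
    degrees of freedom, and a Chernoff bound gives the tail of its square root
    around sqrt r_S ([chi2_tail]).  The exponential moment is computed without
    rotating xi: one unit vector of the range of Pi is removed at a time, and
    its square is linearized by an auxiliary Gaussian variable ([quad_mgf]), so
    that only the Laplace transform of linear forms in xi is needed.

    Range part.  A may have more rows than its rank k = n - r_S, and a union
    bound over the rows would put the number of rows in the logarithm instead of
    k.  Weights repair this.  In the l1 norm the range of A has an Auerbach
    basis; adding up the absolute values of its k vectors coordinatewise gives
    weights l_i of total mass at most k with |(A h)_i| <= l_i |A h|_1 for all h
    ([exists_sup_weights]).  Let th_i be the inner product of xi with the i-th
    column of A^+.  If <th, A h> > tau |A h|_1 for a single h, convexity of the
    exponential forces
      sum_i l_i (e^(nu th_i) + e^(- nu th_i)) >= e^(nu tau)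
    ([exp_weight_lower]).  The expectation of the left-hand side is at most
    2 k e^(nu^2 V / 2), where V bounds the squared norms of the columns of A^+,
    and Markov's inequality gives the probability 2 k e^(- s^2 / 2) with
    s^2 = 2 log (2 k) + 2 t, that is e^(- t) ([range_noise_tail]).

    Measurability of the event holds because the estimator is a 1-Lipschitz
    function of the observation ([estimator_lipschitz],
    [measurable_lipschitz]). *)

(** * Inner product and l1 norm *)

Section InnerProduct.
Context {R : realType}.

Definition dotp n (u v : 'cV[R]_n) : R := (u^T *m v) 0 0.

Lemma dotpE n (u v : 'cV[R]_n) : dotp u v = \sum_i u i 0 * v i 0.
Proof. by rewrite /dotp mxE; apply: eq_bigr => i _; rewrite mxE. Qed.

Lemma dotpC n (u v : 'cV[R]_n) : dotp u v = dotp v u.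
Proof. by rewrite !dotpE; apply: eq_bigr => i _; rewrite mulrC. Qed.

Lemma dotpDr n (u v w : 'cV[R]_n) : dotp u (v + w) = dotp u v + dotp u w.
Proof. by rewrite /dotp mulmxDr mxE. Qed.

Lemma dotpDl n (u v w : 'cV[R]_n) : dotp (v + w) u = dotp v u + dotp w u.
Proof. by rewrite dotpC dotpDr !(dotpC u). Qed.

Lemma dotpZr n (u v : 'cV[R]_n) a : dotp u (a *: v) = a * dotp u v.
Proof. by rewrite /dotp -scalemxAr mxE. Qed.

Lemma dotpZl n (u v : 'cV[R]_n) a : dotp (a *: v) u = a * dotp v u.
Proof. by rewrite dotpC dotpZr dotpC. Qed.

Lemma dotpNr n (u v : 'cV[R]_n) : dotp u (- v) = - dotp u v.
Proof. by rewrite -scaleN1r dotpZr mulN1r. Qed.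

Lemma dotpNl n (u v : 'cV[R]_n) : dotp (- v) u = - dotp v u.
Proof. by rewrite dotpC dotpNr dotpC. Qed.

Definition dotp_lin := (dotpDl, dotpDr, dotpNl, dotpNr, dotpZl, dotpZr).

Lemma dotp_tr m n (A : 'M[R]_(m, n)) u v : dotp u (A *m v) = dotp (A^T *m u) v.
Proof. by rewrite /dotp trmx_mul trmxK mulmxA. Qed.

Lemma dotp_ge0 n (u : 'cV[R]_n) : 0 <= dotp u u.
Proof. by rewrite dotpE sumr_ge0// => i _; rewrite -expr2 sqr_ge0. Qed.

Lemma dotp_eq0 n (u : 'cV[R]_n) : dotp u u = 0 -> u = 0.
Proof.
move=> u0; apply: trmx_inj; rewrite trmx0; apply: row_mul_tr_eq0.
by rewrite trmxK; apply/matrixP => i j; rewrite !ord1 -[LHS]/(dotp u u) u0 mxE.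
Qed.

Lemma dotp_le_sqr n (u v : 'cV[R]_n) : 2 * dotp u v <= dotp u u + dotp v v.
Proof.
have := dotp_ge0 (u - v); rewrite !dotp_lin (dotpC v u); lra.
Qed.

Lemma sqr_normn_dotp n (f : 'cV[R]_n) : normn f ^+ 2 = dotp f f / n%:R.
Proof. by rewrite sqr_normn dotpE. Qed.

Lemma norm1D n (u v : 'cV[R]_n) : norm1 (u + v) <= norm1 u + norm1 v.
Proof.
by rewrite /norm1 -big_split ler_sum// => i _; rewrite mxE ler_normD.
Qed.

Lemma norm1Z n a (u : 'cV[R]_n) : norm1 (a *: u) = `|a| * norm1 u.
Proof. by rewrite /norm1 mulr_sumr; apply: eq_bigr => i _; rewrite mxE normrM. Qed.

Lemma norm1B n (u v : 'cV[R]_n) : norm1 (u - v) <= norm1 u + norm1 v.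
Proof.
by rewrite (le_trans (norm1D _ _))// -scaleN1r norm1Z normrN1 mul1r.
Qed.

Lemma norm1_eq0_coord n (v : 'cV[R]_n) i : norm1 v = 0 -> v i 0 = 0.
Proof.
move=> /eqP; rewrite psumr_eq0// => /allP/(_ i (mem_index_enum _))/=.
by rewrite normr_eq0 => /eqP.
Qed.

Lemma coord_le_norm1 n (v : 'cV[R]_n) i : `|v i 0| <= norm1 v.
Proof. by rewrite /norm1 (bigD1 i)//= lerDl sumr_ge0. Qed.

Lemma dotp_le_norm1_sqr k (u : 'cV[R]_k) : dotp u u <= norm1 u ^+ 2.
Proof.
rewrite dotpE expr2 {2}/norm1 mulr_sumr; apply: ler_sum => i _.
by rewrite -expr2 -real_normK ?num_real// expr2 ler_wpM2r// coord_le_norm1.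
Qed.

End InnerProduct.

(** * Optimality of the analysis estimator *)

Section Optimality.
Context {R : realType} {m n : nat} (D : 'M[R]_(m, n)).

(** Move from the minimizer [g] towards [f] by a fraction u: the squared norm
    contributes u^2 q with q the squared distance, everything else is bounded by
    a function linear in u.  Minimality, divided by u and taken at u -> 0,
    bounds the linear part, and the quadratic term at u = 1 is left over as the
    margin. *)
Lemma estimator_gap (Y : 'cV[R]_n) lambda g :
  0 <= lambda -> is_analysis_estimator D Y lambda g ->
  forall f, analysis_objective D Y lambda g + normn (f - g) ^+ 2
            <= analysis_objective D Y lambda f.
Proof.
move=> l0 gmin f.
set c := dotp (Y - g) (f - g) / n%:R; set q := normn (f - g) ^+ 2.
have objE u : normn (Y - (g + u *: (f - g))) ^+ 2
    = normn (Y - g) ^+ 2 - 2 * u * c + u ^+ 2 * q.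
  rewrite opprD addrA /q /c !sqr_normn_dotp.
  move: (Y - g) (f - g) => v w; rewrite !dotp_lin (dotpC w v); ring.
have subK : g + 1 *: (f - g) = f by rewrite scale1r addrC subrK.
have := objE 1; rewrite subK /analysis_objective => ->.
suff : 2 * c <= 2 * lambda * (norm1 (D *m f) - norm1 (D *m g)) by rewrite -/q; lra.
have q0 : 0 <= q by rewrite sqr_ge0.
apply/ler_addgt0Pr => e e0.
pose u := Num.min 1 (e / (q + 1)).
have u0 : 0 < u by rewrite lt_min ltr01 divr_gt0//; lra.
have u1 : u <= 1 by rewrite ge_min lexx.
have uq : u * q <= e.
  apply: (@le_trans _ _ (e / (q + 1) * (q + 1))); last by rewrite divfK//; lra.
  by apply: ler_pM => //; [exact: ltW| rewrite ge_min lexx orbT| lra].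
have := gmin (g + u *: (f - g)); rewrite /analysis_objective (objE u).
have : norm1 (D *m (g + u *: (f - g)))
    <= (1 - u) * norm1 (D *m g) + u * norm1 (D *m f).
  have -> : g + u *: (f - g) = (1 - u) *: g + u *: f.
    by rewrite scalerBr scalerBl scale1r addrAC addrA.
  rewrite mulmxDr -!scalemxAr.
  by rewrite (le_trans (norm1D _ _))// !norm1Z !ger0_norm//; lra.
set N := norm1 _; set N1 := norm1 (D *m g); set N2 := norm1 (D *m f) => NN H.
have {}NN : 2 * lambda * N <= 2 * lambda * ((1 - u) * N1 + u * N2).
  by apply: ler_wpM2l => //; lra.
have : u * (2 * c) <= u * (2 * lambda * (N2 - N1) + u * q) by nra.
by rewrite ler_pM2l//; lra.
Qed.

(** Nonexpansiveness of proximal maps: adding the two strong minimality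
    inequalities cancels both penalties. *)
Lemma estimator_lipschitz (Y Y' : 'cV[R]_n) lambda g g' :
  0 <= lambda -> (0 < n)%N ->
  is_analysis_estimator D Y lambda g -> is_analysis_estimator D Y' lambda g' ->
  dotp (g - g') (g - g') <= dotp (Y - Y') (Y - Y').
Proof.
move=> l0 n0 gm gm'.
have := estimator_gap l0 gm g'; have := estimator_gap l0 gm' g.
rewrite /analysis_objective !sqr_normn_dotp => h h'.
set a := norm1 (D *m g) in h h'; set b := norm1 (D *m g') in h h'.
have : (dotp (g - g') (g - g') + dotp (g' - g) (g' - g)
   + dotp (Y - g) (Y - g) + dotp (Y' - g') (Y' - g')) / n%:R
  <= (dotp (Y - g') (Y - g') + dotp (Y' - g) (Y' - g)) / n%:R.
  by rewrite !mulrDl; lra.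
rewrite ler_pM2r ?invr_gt0 ?ltr0n// => {}h.
have := dotp_ge0 ((Y - Y') - (g - g')).
move: h; rewrite !dotp_lin !(dotpC g) !(dotpC g') !(dotpC Y') ; lra.
Qed.

End Optimality.

(** * Splitting the noise along the kernel of the inactive rows *)

Section Projection.
Context {R : realType}.

(** For a full rank factorization A = C F the product A^+ A is
    F^T (F F^T)^-1 F, and cyclicity turns its trace into that of an identity
    matrix of size the rank. *)
Lemma tr_mpinv_mul m n (A : 'M[R]_(m, n)) : \tr (mpinv A *m A) = (\rank A)%:R.
Proof.
have := moore_penrose_factor (col_base_full A) (row_base_free A).
rewrite mulmx_base => /(moore_penrose_unique (mpinvP A)) ->.
set C := col_base A; set F := row_base A.
have uC : C^T *m C \in unitmx by exact/gram_unit/col_base_full.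
have uF : F *m F^T \in unitmx.
  rewrite -{1}(trmxK F); apply: gram_unit.
  by rewrite /row_full mxrank_tr; exact: row_base_free.
have mulXA (Y : 'M[R]_(n, m)) : Y *m A = Y *m C *m F by rewrite -mulmxA mulmx_base.
rewrite mulXA.
rewrite -[_ *m _ *m C]mulmxA -(mulmxA _ _ C) mulVmx// mulmx1.
by rewrite -mulmxA mxtrace_mulC -mulmxA mulVmx// mxtrace1.
Qed.

Definition kerproj m n (A : 'M[R]_(m, n)) : 'M[R]_n := 1%:M - mpinv A *m A.

Lemma kerproj_sym m n (A : 'M[R]_(m, n)) : (kerproj A)^T = kerproj A.
Proof.
by have [_ _ _ sym] := mpinvP A; rewrite /kerproj linearB/= trmx1 sym.
Qed.

Lemma kerproj_idem m n (A : 'M[R]_(m, n)) : kerproj A *m kerproj A = kerproj A.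
Proof.
have [AXA _ _ _] := mpinvP A.
rewrite {1}/kerproj mulmxBl mul1mx -mulmxA /kerproj mulmxBr mulmx1 mulmxA AXA.
by rewrite subrr mulmx0 subr0.
Qed.

Lemma tr_kerproj m n (A : 'M[R]_(m, n)) : \tr (kerproj A) = (\rank (kermx A^T))%:R.
Proof.
rewrite /kerproj linearB/= mxtrace1 tr_mpinv_mul mxrank_ker mxrank_tr natrB//.
exact: rank_leq_col.
Qed.

(** Only the values of [A] on [v] matter for the component of [u] orthogonal to
    the kernel, which is what an l1 penalty on [A *m v] can control. *)
Lemma dotp_kerproj m n (A : 'M[R]_(m, n)) (u v : 'cV[R]_n) :
  dotp u v = dotp (kerproj A *m u) v + dotp ((mpinv A)^T *m u) (A *m v).
Proof.
rewrite -{1}(kerproj_sym A) -!dotp_tr -dotpDr mulmxA -mulmxDl.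
by rewrite /kerproj subrK mul1mx.
Qed.

End Projection.

Section ActiveRows.
Context {R : realType} {m n : nat} (D : 'M[R]_(m, n)).

Lemma norm1_rows_in (S : {set 'I_m}) (f : 'cV[R]_n) :
  norm1 (rows_in D S *m f) = \sum_(i in S) `|(D *m f) i 0|.
Proof.
rewrite big_enum_val/=; apply: eq_bigr => i _; congr `|_|.
by rewrite !mxE; apply: eq_bigr => j _; rewrite mxE.
Qed.

Lemma norm1_split (S : {set 'I_m}) (f : 'cV[R]_n) :
  norm1 (D *m f) = norm1 (rows_in D S *m f) + norm1 (rows_in D (~: S)%SET *m f).
Proof.
rewrite !norm1_rows_in /norm1 (bigID (mem S))/=; congr (_ + _).
by apply: eq_bigl => i; rewrite inE.
Qed.

Lemma col_mpinv_le (S : {set 'I_m}) i :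
  let B := mpinv (rows_in D (~: S)%SET) in
  (0 < n)%N -> dotp (col i B) (col i B) <= n%:R * scaling_factor D S ^+ 2.
Proof.
move=> B n0.
have -> : dotp (col i B) (col i B) = n%:R * normn (col i B) ^+ 2.
  by rewrite sqr_normn_dotp mulrC divfK// pnatr_eq0 -lt0n.
rewrite ler_wpM2l// lerXn2r ?nnegrE ?normn_ge0//.
- by rewrite (le_trans (normn_ge0 (col i B)))//; exact: le_bigmax.
- exact: le_bigmax.
Qed.

(** The two noise parts are treated differently: the kernel part by
    2 <a, b> <= |a|^2 + |b|^2, where |b|^2 is the margin of [estimator_gap]; the
    range part by the triangle inequality, which cancels the penalty of [fhat]
    on the inactive rows and doubles that of [f]. *)
Lemma oracle_inequality (S : {set 'I_m}) (f0 e f fhat : 'cV[R]_n)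
    (lambda K : R) :
  (0 < n)%N -> 0 < lambda ->
  is_analysis_estimator D (f0 + e) lambda fhat ->
  let A := rows_in D (~: S)%SET in
  dotp e (kerproj A *m e) <= K ->
  (forall h, dotp ((mpinv A)^T *m e) (A *m h) <= n%:R * lambda * norm1 (A *m h)) ->
  normn (fhat - f0) ^+ 2 + 2 * lambda * norm1 (rows_in D S *m fhat)
  <= normn (f - f0) ^+ 2 + K / n%:R + 4 * lambda * norm1 (D *m f).
Proof.
move=> n0 l0 est A noise_ker noise_range.
have := estimator_gap (ltW l0) est f.
rewrite /analysis_objective !sqr_normn_dotp => gap.
set g := f - fhat in gap.
have nR : 0 < n%:R :> R by rewrite ltr0n.
have noise : - 2 * dotp e g <= K + dotp g g
    + 2 * (n%:R * lambda) * (norm1 (A *m f) + norm1 (A *m fhat)).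
  rewrite (dotp_kerproj A).
  have := dotp_le_sqr (kerproj A *m e) (- g).
  have -> : dotp (kerproj A *m e) (kerproj A *m e) = dotp e (kerproj A *m e).
    by rewrite dotp_tr kerproj_sym mulmxA kerproj_idem dotpC.
  rewrite !dotp_lin opprK => q1.
  have := noise_range (fhat - f).
  have -> : dotp ((mpinv A)^T *m e) (A *m (fhat - f))
      = - dotp ((mpinv A)^T *m e) (A *m g).
    by rewrite -dotpNr -mulmxN /g opprB.
  have N : n%:R * lambda * norm1 (A *m (fhat - f))
      <= n%:R * lambda * (norm1 (A *m f) + norm1 (A *m fhat)).
    rewrite ler_wpM2l ?mulr_ge0 ?(ltW nR) ?(ltW l0)// mulmxBr.
    by rewrite (le_trans (norm1B _ _))// addrC.
  by lra.
have expand : dotp (f0 + e - f) (f0 + e - f) - dotp (f0 + e - fhat) (f0 + e - fhat)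
    = dotp (f - f0) (f - f0) - dotp (fhat - f0) (fhat - f0) - 2 * dotp e g.
  rewrite /g !dotp_lin !(dotpC e) !(dotpC fhat) !(dotpC f0); ring.
have nf := norm1_split S f; have nfh := norm1_split S fhat.
rewrite -/A in nf nfh.
have DSf := norm1_ge0 (rows_in D S *m f).
rewrite -(ler_pM2l nR).
have {gap} : n%:R * (dotp (f0 + e - fhat) (f0 + e - fhat) / n%:R
    + 2 * lambda * norm1 (D *m fhat) + dotp g g / n%:R)
    <= n%:R * (dotp (f0 + e - f) (f0 + e - f) / n%:R + 2 * lambda * norm1 (D *m f)).
  by rewrite ler_pM2l.
have cancel_n (a : R) : n%:R * (a / n%:R) = a by rewrite mulrC divfK// gt_eqF.
rewrite !mulrDr !cancel_n => gap.
rewrite nf nfh in gap *.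
have slack : 0 <= n%:R * lambda * norm1 (rows_in D S *m f).
  by rewrite !mulr_ge0// ltW.
by lra.
Qed.

End ActiveRows.

(** * Auerbach bases and supremum weights *)

Section Auerbach.
Context {R : realType}.

Lemma continuous_sum_fun (T : topologicalType) (I : Type) (r : seq I)
    (F : I -> T -> R) :
  (forall i, continuous (F i)) -> continuous (fun x => \sum_(i <- r) F i x).
Proof. by move=> cF; apply: continuous_big => // y; exact: add_continuous. Qed.

Lemma continuous_prod_fun (T : topologicalType) (I : Type) (r : seq I)
    (F : I -> T -> R) :
  (forall i, continuous (F i)) -> continuous (fun x => \prod_(i <- r) F i x).
Proof. by move=> cF; apply: continuous_big => // y; exact: mul_continuous. Qed.

Lemma continuous_mull (T : topologicalType) (c : R) (F : T -> R) :
  continuous F -> continuous (fun x => c * F x).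
Proof. by move=> cF x; apply: cvgM; [exact: cvg_cst|exact: cF]. Qed.

Definition row_subst k (H : 'M[R]_k) (j : 'I_k) (w : 'rV[R]_k) : 'M[R]_k :=
  \matrix_(i, l) if i == j then w 0 l else H i l.

(** Cramer's rule: the cofactors along a row do not see that row. *)
Lemma det_row_subst k (H : 'M[R]_k) j w :
  \det (row_subst H j w) = (w *m \adj H) 0 j.
Proof.
rewrite (expand_det_row _ j) mxE; apply: eq_bigr => l _.
rewrite /row_subst !mxE eqxx; congr (_ * _).
rewrite /cofactor; congr (_ * \det _); apply/matrixP => a b.
by rewrite !mxE eq_sym (negbTE (neq_lift _ _)).
Qed.

(** The set of matrices whose rows h satisfy |C h|_1 <= 1 is compact because [C]
    has the left inverse [L], so that the determinant has a maximum on it; a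
    small multiple of the identity shows that the maximum is positive. *)
Lemma max_det_ball k M (C : 'M[R]_(M, k)) (L : 'M[R]_(k, M)) : L *m C = 1%:M ->
  exists2 H : 'M[R]_k, 0 < \det H /\ (forall j, norm1 (C *m (row j H)^T) <= 1)
    & forall H' : 'M[R]_k, (forall j, norm1 (C *m (row j H')^T) <= 1) ->
      \det H' <= \det H.
Proof.
move=> LC.
pose f (v : 'rV[R]_(k * k)) := \det (vec_mx v : 'M[R]_k).
pose g (j : 'I_k) (v : 'rV[R]_(k * k)) := norm1 (C *m (row j (vec_mx v))^T).
pose X := [set v | forall j, g j v <= 1].
have cvec i l : continuous (fun x : 'rV[R]_(k * k) => vec_mx x i l : R).
  have -> : (fun x : 'rV[R]_(k * k) => vec_mx x i l) =
            (fun x => x 0 (mxvec_index i l)).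
    by apply/funext => x; rewrite mxE.
  by move=> x; exact: coord_continuous.
have cf : continuous f.
  apply: continuous_sum_fun => s.
  apply: continuous_mull; apply: continuous_prod_fun => i v.
  move: (perm.fun_of_perm s i) => l; move: v.
  exact: cvec.
have cg j : continuous (g j).
  apply: continuous_sum_fun => i v.
  apply: (cvg_comp (fun v => (C *m (row j (vec_mx v))^T) i 0)); last first.
    exact: norm_continuous.
  have gE : (fun v : 'rV[R]_(k * k) => (C *m (row j (vec_mx v))^T) i 0) =
            (fun x => \sum_l C i l * x 0 (mxvec_index j l)).
    by apply/funext => x; rewrite mxE; apply: eq_bigr => l _; rewrite !mxE.
  move: v; rewrite -/(continuous _) gE; apply: continuous_sum_fun.
  by move=> l; apply: continuous_mull => v; exact: coord_continuous.
have Xcl : closed X.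
  have -> : X = \bigcap_(j in [set: 'I_k]) (g j @^-1` [set y | y <= 1]).
    by apply/seteqP; split => v Xv j => [_|]; exact: Xv.
  by apply: closed_bigI => j _; apply: preimage_closed => //; exact: closed_le.
have HL H : (forall j, norm1 (C *m (row j H)^T) <= 1) ->
    forall j l, `|H j l| <= \sum_i norm1 (row i L)^T.
  move=> HX j l.
  have -> : H j l = (L *m (C *m (row j H)^T)) l 0 by rewrite mulmxA LC mul1mx !mxE.
  rewrite (bigD1 l)//= mxE; apply: ler_wpDr.
    by apply: sumr_ge0 => ? _; exact: norm1_ge0.
  rewrite (le_trans (ler_norm_sum _ _ _))//; apply: ler_sum => i _.
  rewrite normrM [(row l L)^T i 0]mxE [row l L 0 i]mxE ler_piMr//.
  by apply: le_trans (HX j); exact: coord_le_norm1.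
have Xb : bounded_set X.
  exists (\sum_i norm1 (row i L)^T); split; first by rewrite num_real.
  move=> y Ly v Xv; rewrite /= [leLHS]/Num.norm/= mx_normrE.
  apply/bigmax_leP; split.
    apply: le_trans (ltW Ly); apply: sumr_ge0 => ? _; exact: norm1_ge0.
  case=> a b _ /=; rewrite ord1 -(vec_mxK v); case/mxvec_indexP: b => i j.
  rewrite mxvecE; apply: le_trans (ltW Ly).
  exact: HL.
pose a : R := (1 + \sum_i norm1 (col i C))^-1.
have S0 : 0 <= \sum_i norm1 (col i C) by apply: sumr_ge0 => ? _; exact: norm1_ge0.
have a0 : 0 < a by rewrite invr_gt0; lra.
have aX : X (mxvec (a%:M)).
  move=> j; rewrite /g mxvecK.
  have -> : (row j (a%:M : 'M[R]_k))^T = a *: delta_mx j 0.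
    by apply/colP => l; rewrite !mxE eq_sym mulr_natr andbT.
  rewrite -scalemxAr -colE norm1Z gtr0_norm// ler_pdivrMl; last lra.
  rewrite mulr1 (bigD1 j)//= addrCA lerDl addr_ge0// sumr_ge0// => ? _.
  exact: norm1_ge0.
have [v vX vmax] : exists2 c, c \in X & forall t, t \in X -> f t <= f c.
  apply: EVT_max_rV; first by exists (mxvec a%:M).
  - exact: bounded_closed_compact.
  - by apply: continuous_subspaceT => ? ; exact: cf.
rewrite inE in vX.
exists (vec_mx v); first split => //.
  apply: (@lt_le_trans _ _ (f (mxvec a%:M))); last by apply: vmax; rewrite inE.
  by rewrite /f mxvecK det_scalar exprn_gt0.
move=> H' HX'; have := vmax (mxvec H'); rewrite /f mxvecK; apply.
by rewrite inE /X/= /g mxvecK.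
Qed.

(** The rows of a matrix [H] of maximal determinant form an Auerbach basis of
    the unit ball of h |-> |C h|_1: replacing a row of [H] by a vector of the
    ball multiplies the determinant by a coordinate of that vector, which
    therefore is at most 1 in absolute value.  Expanding h in this basis bounds
    each |(C h)_i| by the sum over the basis of the |(C h_j)_i|, times
    |C h|_1. *)
Lemma auerbach_weights M k (C : 'M[R]_(M, k)) (L : 'M[R]_(k, M)) :
  L *m C = 1%:M ->
  exists lam : 'I_M -> R, [/\ forall i, 0 <= lam i, \sum_i lam i <= k%:R &
    forall (h : 'cV[R]_k) i, `|(C *m h) i 0| <= lam i * norm1 (C *m h)].
Proof.
move=> LC; have [H [dH HX] Hmax] := max_det_ball LC.
exists (fun i => \sum_j `|(C *m (row j H)^T) i 0|); split => [i||h i].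
- exact: sumr_ge0.
- have -> : k%:R = \sum_(j < k) (1 : R) by rewrite sumr_const card_ord.
  rewrite exchange_big/=; by apply: ler_sum => j _; exact: HX.
have [N0|N0] := eqVneq (norm1 (C *m h)) 0.
  by rewrite N0 mulr0 norm1_eq0_coord// normr0.
have {}N0 : 0 < norm1 (C *m h) by rewrite lt_neqAle eq_sym N0 norm1_ge0.
set N := norm1 _ in N0 *.
have uH : H \in unitmx by rewrite unitmxE unitfE gt_eqF.
pose w := h^T *m invmx H.
have hE : h^T = w *m H by rewrite mulmxKV.
clearbody w.
have wle j : `|w 0 j| <= N.
  have wadj : w 0 j * \det H = (h^T *m \adj H) 0 j.
    by rewrite hE -mulmxA mul_mx_adj mul_mx_scalar mxE mulrC.
  (* both signs are needed since the determinant itself is maximized *)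
  suff sgn (e : R) : `|e| <= 1 -> e * w 0 j <= N.
    by rewrite ler_norml -[w 0 j]mul1r sgn ?normr1// lerNl -mulNr sgn// normrN1.
  move=> e1; rewrite -(ler_pM2r dH) -mulrA wadj.
  have -> : e * (h^T *m \adj H) 0 j = N * \det (row_subst H j ((e / N) *: h^T)).
    rewrite det_row_subst -scalemxAl [fun_of_matrix (_ *: _) _ _]mxE mulrA.
    congr (_ * _).
    by rewrite mulrC divfK// gt_eqF.
  rewrite ler_pM2l//; apply: Hmax => j'; have [->|jj] := eqVneq j' j.
    have -> : (row j (row_subst H j ((e / N) *: h^T)))^T = (e / N) *: h.
      by apply/colP => l; rewrite !mxE eqxx.
    rewrite -scalemxAr norm1Z normrM -/N normfV (ger0_norm (ltW N0)).
    by rewrite divfK// gt_eqF.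
  have -> : row j' (row_subst H j ((e / N) *: h^T)) = row j' H.
    by apply/rowP => l; rewrite !mxE (negbTE jj).
  exact: HX.
have -> : (C *m h) i 0 = \sum_j w 0 j * (C *m (row j H)^T) i 0.
  have -> : h = \sum_j w 0 j *: (row j H)^T.
    apply: trmx_inj; rewrite hE mulmx_sum_row linear_sum/=.
    by apply: eq_bigr => j _; rewrite linearZ/= trmxK.
  rewrite mulmx_sumr summxE; apply: eq_bigr => j _.
  by rewrite -scalemxAr mxE.
rewrite mulrC mulr_sumr (le_trans (ler_norm_sum _ _ _))//.
by apply: ler_sum => j _; rewrite normrM ler_wpM2r.
Qed.

(** These weights act as the number of terms of a union bound over the rows of
    [A], but their total mass is the rank instead of the number of rows. *)
Lemma exists_sup_weights M n (A : 'M[R]_(M, n)) :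
  exists lam : 'I_M -> R, [/\ forall i, 0 <= lam i, \sum_i lam i <= (\rank A)%:R &
    forall (h : 'cV[R]_n) i, `|(A *m h) i 0| <= lam i * norm1 (A *m h)].
Proof.
have /row_fullP[L LC] := col_base_full A.
have [lam [lam0 sum_lam lamP]] := auerbach_weights LC.
exists lam; split=> // h i.
have -> : A *m h = col_base A *m (row_base A *m h) by rewrite mulmxA mulmx_base.
exact: lamP.
Qed.

End Auerbach.

(** * Integrals against densities and Gaussian laws *)

Section Density.
Local Open Scope ereal_scope.
Context {R : realType} d d' (T : measurableType d) (T' : measurableType d').
Variables (mu : {measure set T -> \bar R}) (nu : {measure set T' -> \bar R}).
Variables (X : T -> T') (mX : measurable_fun setT X).
Variables (G : T -> R) (mG : measurable_fun setT G) (G0 : forall x, (0 <= G x)%R).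
Hypothesis nuE : forall B, measurable B ->
  nu B = \int[mu]_x (\1_B (X x) * G x)%:E.

Import HBNNSimple.

Let mindic (r : R) (B : set T') : measurable B ->
  measurable_fun setT (fun x => (r * (\1_B (X x) * G x))%:E).
Proof.
move=> mB; apply/measurable_EFinP; apply: measurable_funM => //.
by apply: measurable_funM => //; exact: measurableT_comp.
Qed.

Let integral_density_nnsfun (h : {nnsfun T' >-> R}) :
  \int[nu]_y (h y)%:E = \int[mu]_x (h (X x) * G x)%:E.
Proof.
have mh r : measurable (h @^-1` [set r]) by [].
have h0 r x : (0 <= r * \1_(h @^-1` [set r]) x)%R.
  by have := nnfun_muleindic_ge0 h r x; rewrite -EFinM lee_fin.
under [LHS]eq_integral do rewrite fimfunE -fsumEFin//.
rewrite [LHS]ge0_integral_fsum//; last 2 first.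
- by move=> r; exact/measurable_EFinP/measurable_funM.
- by move=> r x _; rewrite lee_fin.
transitivity (\int[mu]_x (\sum_(r \in range h)
    (r * (\1_(h @^-1` [set r]) (X x) * G x))%:E)); last first.
  apply: eq_integral => x _; rewrite fimfunE EFinM -fsumEFin//.
  rewrite ge0_mule_fsuml//; first by apply: eq_fsbigr => r _; rewrite -EFinM mulrA.
  by move=> r; rewrite lee_fin.
rewrite ge0_integral_fsum//; last 2 first.
- by move=> r; exact: mindic.
- by move=> r x _; rewrite lee_fin mulrA mulr_ge0.
apply: eq_fsbigr => r /[!inE] -[t _ <-].
under eq_integral do rewrite EFinM.
rewrite ge0_integralZl//; last 2 first.
- by apply/measurable_EFinP; exact: measurable_indic.
- by rewrite lee_fin.
rewrite integral_indic// setIT nuE// -ge0_integralZl//; last 3 first.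
- apply/measurable_EFinP; apply: measurable_funM => //.
  exact: measurableT_comp.
- by move=> x _; rewrite lee_fin mulr_ge0.
- by rewrite lee_fin.
Qed.

(** A measure given on sets by weighting a pullback is given on functions by the
    same formula: by linearity for simple functions, and by monotone convergence
    in general. *)
Lemma integral_density (f : T' -> R) : measurable_fun setT f ->
  (forall y, (0 <= f y)%R) ->
  \int[nu]_y (f y)%:E = \int[mu]_x (f (X x) * G x)%:E.
Proof.
move=> mf f0.
have mF : measurable_fun setT (EFin \o f) by exact/measurable_EFinP.
have F0 : forall x, setT x -> 0 <= (EFin \o f) x by move=> x _; rewrite lee_fin.
pose h := nnsfun_approx measurableT mF.
have -> : \int[nu]_y (f y)%:E = limn (fun n => \int[nu]_y (h n y)%:E).
  rewrite -monotone_convergence//=.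
  - by apply: eq_integral => y _; apply/esym/cvg_lim => //; exact: cvg_nnsfun_approx.
  - by move=> n; exact/measurable_EFinP.
  - by move=> n y _; rewrite lee_fin.
  - by move=> y _ a b ab; rewrite lee_fin; exact/lefP/nd_nnsfun_approx.
have -> : \int[mu]_x (f (X x) * G x)%:E =
    limn (fun n => \int[mu]_x (h n (X x) * G x)%:E).
  rewrite -monotone_convergence//=.
  - apply: eq_integral => x _; apply/esym/cvg_lim => //.
    under eq_fun do rewrite EFinM.
    by rewrite EFinM; apply: cvgeZr => //;
      exact: (cvg_nnsfun_approx measurableT mF F0).
  - move=> n; apply/measurable_EFinP; apply: measurable_funM => //.
    exact: measurableT_comp.
  - by move=> n x _; rewrite lee_fin mulr_ge0.
  - move=> x _ a b ab; rewrite lee_fin ler_wpM2r//.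
    exact/lefP/nd_nnsfun_approx.
by congr (limn _); apply/funext => n; exact: integral_density_nnsfun.
Qed.

End Density.

Section GaussianIntegrals.
Context {R : realType}.

Lemma integral_normal_prob (m s : R) (f : R -> R) :
  measurable_fun setT f -> (forall x, 0 <= f x) ->
  (\int[normal_prob m s]_x (f x)%:E =
   \int[lebesgue_measure]_x (f x * normal_pdf m s x)%:E)%E.
Proof.
move=> mf f0.
apply: (@integral_density _ _ _ _ _ lebesgue_measure (normal_prob m s) id) => //.
- exact: measurable_normal_pdf.
- by move=> x; exact: normal_pdf_ge0.
move=> B mB.
transitivity (\int[lebesgue_measure]_(x in B) (normal_pdf m s x)%:E)%E => //.
rewrite [LHS]integral_mkcond; apply: eq_integral => x _; rewrite patchE indicE.
by case: ifPn => xB; rewrite (mul1r, mul0r).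
Qed.

(** Completing the square: the integrand times the density with mean 0 and
    standard deviation [s] is a multiple of the density with mean b (s / c)^2 and
    standard deviation s / c. *)
Lemma normal_expR_quad (s c b : R) : 0 < s -> 0 < c ->
  (\int[normal_prob 0 s]_z
     (expR (b * z + (1 - c ^+ 2) / (2 * s ^+ 2) * z ^+ 2))%:E
   = (c^-1 * expR (b ^+ 2 * s ^+ 2 / (2 * c ^+ 2)))%:E)%E.
Proof.
move=> s0 c0.
have sn0 : s != 0 by rewrite gt_eqF.
have cn0 : c != 0 by rewrite gt_eqF.
have tn0 : s / c != 0 by rewrite mulf_neq0// invr_neq0.
rewrite integral_normal_prob; last 2 first.
- apply: measurableT_comp => //; apply: measurable_funD.
    exact: measurable_funM.
  by apply: measurable_funM => //; exact: exprn_measurable.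
- by move=> x; exact: expR_ge0.
set K := c^-1 * _.
transitivity (\int[lebesgue_measure]_z
    (K%:E * (normal_pdf (b * (s / c) ^+ 2) (s / c) z)%:E))%E; last first.
  rewrite ge0_integralZl//=.
  - by rewrite integral_normal_pdf mule1.
  - by apply/measurable_EFinP; exact: measurable_normal_pdf.
  - by move=> x _; rewrite lee_fin normal_pdf_ge0.
  - by rewrite lee_fin mulr_ge0 ?expR_ge0// invr_ge0 ltW.
apply: eq_integral => z _; rewrite -EFinM; congr EFin.
rewrite !normal_pdfE// /normal_fun.
have -> : normal_peak (s / c) = c * normal_peak s.
  rewrite /normal_peak exprMn; move: (pi : R) => p.
  rewrite (mulrC (s ^+ 2)) -mulrA -mulrnAr.
  rewrite sqrtrM ?sqr_ge0// sqrtr_sqr ger0_norm ?invr_ge0 ?(ltW c0)//.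
  by rewrite invfM invrK.
have cancel_c p e1 e2 : c^-1 * e1 * (c * p * e2) = p * (e1 * e2) by field.
rewrite /K cancel_c -expRD mulrCA -expRD; congr (_ * expR _).
by field; rewrite sn0 cn0.
Qed.

Lemma normal_mgf (s b : R) : 0 < s ->
  (\int[normal_prob 0 s]_z (expR (b * z))%:E
   = (expR (s ^+ 2 * b ^+ 2 / 2))%:E)%E.
Proof.
move=> s0; have := normal_expR_quad b s0 ltr01.
rewrite expr1n subrr mul0r invr1 mul1r mulr1 (mulrC (b ^+ 2)) => <-.
by apply: eq_integral => z _; rewrite mul0r addr0.
Qed.

End GaussianIntegrals.

(** * Independence *)

Section Independence.
Context {R : realType} {d : measure_display} {T : measurableType d}.
Variable P : probability T R.
Variables (n : nat) (X : 'I_n -> {RV P >-> R}).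
Hypothesis indep : mutually_independent X.

(** Functions replace indicators one coordinate at a time: with the other
    factors fixed, both sides are measures in the set whose indicator is used at
    the current coordinate, and [integral_density] passes from sets to
    functions. *)
Lemma expectation_prod_indep (F : 'I_n -> R -> R) (c : 'I_n -> R) :
  (forall i, measurable_fun setT (F i)) -> (forall i x, 0 <= F i x) ->
  (forall i, \int[P]_w (F i (X i w))%:E = (c i)%:E)%E ->
  (\int[P]_w (\prod_i F i (X i w))%:E = (\prod_i c i)%:E)%E.
Proof.
(* coordinates from [j] on still carry indicators *)
suff H (j : nat) : (j <= n)%N -> forall (F : 'I_n -> R -> R) (c : 'I_n -> R),
    (forall i, measurable_fun setT (F i)) -> (forall i x, 0 <= F i x) ->
    (forall i : 'I_n, (j <= i)%N -> exists2 B, measurable B & F i = \1_B) ->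
    (forall i, \int[P]_w (F i (X i w))%:E = (c i)%:E)%E ->
    (\int[P]_w (\prod_i F i (X i w))%:E = (\prod_i c i)%:E)%E.
  move=> mF F0 cE; apply: (H n) => // i.
  by rewrite leqNgt ltn_ord.
elim: j => [_|j IH jn] {}F {}c mF F0 FB cE.
  have /choice[B BE] (i : 'I_n) : exists B, measurable B /\ F i = \1_B.
    by have [B mB FE] := FB i (leq0n i); exists B.
  have mB i : measurable (B i) by have [] := BE i.
  have mXB i : measurable (X i @^-1` B i).
    by rewrite -[X in measurable X]setTI; exact: measurable_funPT.
  have cPE i : P (X i @^-1` B i) = (c i)%:E.
    rewrite -cE -(setIT (X i @^-1` B i)) -integral_indic//.
    by apply: eq_integral => w _; have [_ ->] := BE i.
  have := indep mB.
  rewrite (eq_bigr (fun i => (c i)%:E)) => [|i _]; last exact: cPE.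
  rewrite prodEFin => <-.
  rewrite -[X in P X]setIT -integral_indic//; last first.
    exact: fin_bigcap_measurable.
  apply: eq_integral => w _; congr EFin.
  rewrite indicE.
  have [/set_mem wB|/negP wB] := boolP (w \in \bigcap_i (X i @^-1` B i)).
    apply: big1 => i _; have [_ ->] := BE i.
    by rewrite indicE mem_set//; exact: wB.
  have [i wBi] : exists i, ~ B i (X i w).
    by apply/existsNP => wB'; apply: wB; rewrite inE => i _; exact: wB'.
  rewrite (bigD1 i)//=; have [_ ->] := BE i.
  by rewrite indicE memNset// mul0r.
pose i0 := Ordinal jn.
pose G w := \prod_(i | i != i0) F i (X i w).
pose c' := \prod_(i | i != i0) c i.
have c0 i : 0 <= c i.
  by rewrite -lee_fin -cE; apply: integral_ge0 => w _; rewrite lee_fin.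
have c'0 : 0 <= c' by exact: prodr_ge0.
(* the product rule in the set used at coordinate [i0] *)
pose nu := mscale (NngNum c'0) (distribution P (X i0)).
have mG : measurable_fun setT G.
  rewrite /G; under eq_fun do rewrite -big_filter.
  by apply: measurable_prod => i _; exact: measurableT_comp.
have := @integral_density _ _ _ _ _ P nu (X i0) _ G mG _ _ (F i0) (mF i0) (F0 i0).
rewrite ge0_integral_mscale//=; last first.
- by move=> x _; rewrite lee_fin.
- exact/measurable_EFinP.
rewrite ge0_integral_distribution//; last 2 first.
- exact/measurable_EFinP.
- by move=> x; rewrite lee_fin.
rewrite /= cE -EFinM => intE.
rewrite [in RHS](bigD1 i0)//= mulrC intE//.
- by apply: eq_integral => w _; rewrite (bigD1 i0).
- by move=> w; exact: prodr_ge0.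
move=> B mB.
have mXB : measurable (X i0 @^-1` B).
  by rewrite -[X in measurable X]setTI; exact: measurable_funPT.
pose F' i := if i == i0 then \1_B else F i : R -> R.
pose e i := if i == i0 then fine (P (X i0 @^-1` B)) else c i.
have := IH (ltnW jn) F' e; rewrite (bigD1 i0)//= [e i0]/e eqxx.
rewrite (eq_bigr c); last by move=> i /negbTE ii0; rewrite /e ii0.
rewrite -/c' EFinM fineK ?fin_num_measure//.
rewrite muleC /nu /mscale/= /distribution/= /pushforward => <-.
- apply: eq_integral => w _; rewrite (bigD1 i0)//= [F' i0]/F' eqxx.
  by congr (_ * _)%:E; apply: eq_bigr => i /negbTE ii0; rewrite /F' ii0.
- by move=> i; rewrite /F'; case: ifP => // _; exact: measurable_indic.
- by move=> i x; rewrite /F'; case: ifP => // _; rewrite indicE.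
- move=> i ji; rewrite /F'; case: ifPn => [_|ii0]; first by exists B.
  apply: FB; rewrite ltn_neqAle ji andbT.
  by apply: contraNneq ii0 => ij; apply/eqP/val_inj.
- move=> i; rewrite /F' /e; case: eqVneq => [->|_]; last exact: cE.
  rewrite fineK ?fin_num_measure// -[in RHS](setIT (X i0 @^-1` B)).
  by rewrite -integral_indic.
Qed.

End Independence.

Section Noise.
Context {R : realType} {d : measure_display} {T : measurableType d}.
Variable P : probability T R.

Lemma iid_normal_mgf n (sigma : R) (eps : 'I_n -> {RV P >-> R}) (a : 'cV[R]_n) :
  0 < sigma -> iid_normal sigma eps ->
  (\int[P]_w (expR (dotp a (sigma^-1 *: rvec eps w)))%:E
   = (expR (dotp a a / 2))%:E)%E.
Proof.
move=> s0 [indep law].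
have := expectation_prod_indep indep (F := fun i y => expR (a i 0 / sigma * y))
  (c := fun i => expR (a i 0 ^+ 2 / 2)).
rewrite -expR_sum -mulr_suml => prodE.
rewrite [dotp a a]dotpE -prodE.
- apply: eq_integral => w _; rewrite -expR_sum; congr (expR _)%:E.
  by rewrite dotpE; apply: eq_bigr => i _; rewrite !mxE mulrA.
- by move=> i; apply: measurableT_comp => //; exact: measurable_funM.
- by move=> i y; exact: expR_ge0.
move=> i; have meps : measurable_fun setT (eps i) by [].
have -> : expR (a i 0 ^+ 2 / 2) = expR (sigma ^+ 2 * (a i 0 / sigma) ^+ 2 / 2).
  by congr expR; field; rewrite gt_eqF.
rewrite -normal_mgf// (@integral_density _ _ _ _ _ P (normal_prob 0 sigma)
  (eps i) _ (cst 1))//=.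
- by apply: eq_integral => w _; rewrite mulr1.
- move=> B mB; transitivity (P (eps i @^-1` B)); first exact/esym/(law i B mB).
  rewrite -[X in P X]setIT -integral_indic//; last first.
    by rewrite -[X in measurable X]setTI; exact: measurable_funPT.
  by apply: eq_integral => w _; rewrite mulr1.
- by apply: measurableT_comp => //; exact: measurable_funM.
Qed.

End Noise.

(** * Chi-square tail *)

Section Markov.
Context {R : realType} {d : measure_display} {T : measurableType d}.
Variable P : probability T R.

Lemma markov_ge0 (f : T -> R) (C K : R) : measurable_fun setT f ->
  (forall w, 0 <= f w) -> (\int[P]_w (f w)%:E <= C%:E)%E -> 0 < K ->
  measurable [set w | K <= f w] /\ (P [set w | (K <= f w)%R] <= (C / K)%:E)%E.
Proof.
move=> mf f0 fC K0.
have mA : measurable [set w | K <= f w].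
  by rewrite -[X in measurable X]setTI; apply: measurable_fun_le.
split=> //.
rewrite EFinM lee_pdivlMr// (le_trans _ fC)//.
rewrite -[X in P X]setIT -integral_indic// -ge0_integralZr//; last 2 first.
- by apply/measurable_EFinP; exact: measurable_indic.
- by rewrite lee_fin ltW.
apply: ge0_le_integral => //.
- by move=> w _; rewrite mule_ge0// lee_fin ?(ltW K0)//.
- apply: emeasurable_funM => //; exact/measurable_EFinP.
- exact/measurable_EFinP.
- move=> w _; rewrite -EFinM lee_fin indicE.
  have [/set_mem wA|_] := boolP (w \in _); first by rewrite mul1r.
  by rewrite mul0r.
Qed.

End Markov.

Section OrthogonalProjection.
Context {R : realType} {n : nat}.

(** The trace of Q^T Q is the sum of the squared norms of the columns. *)
Lemma sym_idem_tr0 (Q : 'M[R]_n) : Q^T = Q -> Q *m Q = Q -> \tr Q = 0 -> Q = 0.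
Proof.
move=> Qs QQ trQ.
have : \tr (Q^T *m Q) = \sum_i dotp (col i Q) (col i Q).
  by apply: eq_bigr => i _; rewrite dotpE mxE; apply: eq_bigr => j _; rewrite !mxE.
rewrite Qs QQ trQ => /esym/eqP; rewrite psumr_eq0 => [/allP/= Q0|i _]; last first.
  exact: dotp_ge0.
apply/matrixP => i j; have /eqP/dotp_eq0/colP/(_ i) := Q0 j (mem_index_enum _).
by rewrite !mxE.
Qed.

(** The induction step on the trace of an orthogonal projection: a normalized
    nonzero column q is fixed by [Q], and removing q q^T lowers the trace by 1. *)
Lemma sym_idem_split (Q : 'M[R]_n) r : Q^T = Q -> Q *m Q = Q ->
  \tr Q = r.+1%:R ->
  exists q : 'cV[R]_n, let Q' := Q - q *m q^T in
    [/\ dotp q q = 1, Q' *m q = 0, Q'^T = Q', Q' *m Q' = Q' & \tr Q' = r%:R].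
Proof.
move=> Qs QQ trQ.
have [j Qj] : exists j, col j Q != 0.
  apply/existsP; apply: contraPT trQ => /existsPn Q0.
  have -> : Q = 0.
    by apply/matrixP => i j; have /eqP/colP/(_ i) := negPn (Q0 j); rewrite !mxE.
  by rewrite mxtrace0 => /esym/eqP; rewrite pnatr_eq0.
set v := col j Q in Qj.
have Qv : Q *m v = v by rewrite /v colE mulmxA QQ.
have v0 : 0 < dotp v v.
  rewrite lt_neqAle dotp_ge0 andbT eq_sym.
  by apply: contra Qj => /eqP/dotp_eq0 ->.
exists ((Num.sqrt (dotp v v))^-1 *: v); set q := _ *: v => Q'.
have qq : dotp q q = 1.
  rewrite !dotp_lin mulrA -expr2 exprVn sqr_sqrtr ?ltW// mulVf// gt_eqF//.
have Qq : Q *m q = q by rewrite -scalemxAr Qv.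
have qTq : q^T *m q = 1%:M.
  by apply/matrixP => a b; rewrite !ord1 -[LHS]/(dotp q q) qq mxE.
have qTQ : q^T *m Q = q^T by rewrite -{1}Qs -trmx_mul Qq.
have Q'q : Q' *m q = 0 by rewrite mulmxBl -mulmxA qTq mulmx1 Qq subrr.
split=> //.
- by rewrite /Q' linearB/= trmx_mul trmxK Qs.
- by rewrite {2}/Q' mulmxBr mulmxA Q'q mul0mx subr0 mulmxBl QQ -mulmxA qTQ.
- rewrite /Q' linearB/= trQ mxtrace_mulC qTq mxtrace1 -natr1; ring.
Qed.

End OrthogonalProjection.

Section GaussianVector.
Context {R : realType} {d : measure_display} {T : measurableType d}.
Variable P : probability T R.

Variables (n : nat) (xi : T -> 'cV[R]_n).
Hypothesis mxi : forall i, measurable_fun setT (fun w => xi w i 0).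
Hypothesis xi_mgf : forall a : 'cV[R]_n,
  (\int[P]_w (expR (dotp a (xi w)))%:E = (expR (dotp a a / 2))%:E)%E.

Lemma measurable_dotp (a : 'cV[R]_n) : measurable_fun setT (fun w => dotp a (xi w)).
Proof.
under eq_fun do rewrite dotpE.
by apply: measurable_sum => i; exact: measurable_funM.
Qed.

Lemma measurable_quad (Q : 'M[R]_n) :
  measurable_fun setT (fun w => dotp (xi w) (Q *m xi w)).
Proof.
under eq_fun do rewrite dotpE.
apply: measurable_sum => i; apply: measurable_funM => //.
under eq_fun do rewrite mxE.
by apply: measurable_sum => j; exact: measurable_funM.
Qed.

(** Induction on the trace.  If q is the direction split off by
    [sym_idem_split] and s^2 = 1 - c^2, then e^(s^2 <q, xi>^2 / 2) is the mean of
    e^(s z <q, xi>) over a standard Gaussian z; exchanging the integrals reduces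
    to the smaller projection with [a] replaced by a + s z q.  The linear form
    [a] is there to make this induction go through. *)
Lemma quad_mgf (r : nat) (Q : 'M[R]_n) (c : R) :
  Q^T = Q -> Q *m Q = Q -> \tr Q = r%:R -> 0 < c -> c <= 1 ->
  forall a : 'cV[R]_n,
  (\int[P]_w (expR (dotp a (xi w)
                    + (1 - c ^+ 2) / 2 * dotp (xi w) (Q *m xi w)))%:E
   = (c ^- r * expR ((dotp a a + (1 - c ^+ 2) / c ^+ 2 * dotp a (Q *m a)) / 2))%:E)%E.
Proof.
move=> + + + c0 c1; elim: r Q => [|r IH] Q Qs QQ trQ a.
  rewrite (sym_idem_tr0 Qs QQ trQ) expr0 invr1 mul1r mul0mx.
  have -> : dotp a 0 = 0 by rewrite -(scale0r (0 : 'cV[R]_n)) dotpZr mul0r.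
  rewrite mulr0 addr0 -(xi_mgf a); apply: eq_integral => w _.
  rewrite mul0mx.
  have -> : dotp (xi w) 0 = 0 by rewrite -(scale0r (0 : 'cV[R]_n)) dotpZr mul0r.
  by rewrite mulr0 addr0.
have [q] := sym_idem_split Qs QQ trQ.
set Q' := Q - _; case=> qq Q'q Q's Q'Q' trQ'.
have QE v : dotp v (Q *m v) = dotp v (Q' *m v) + dotp q v ^+ 2.
  rewrite mulmxBl dotpDr dotpNr -mulmxA.
  have -> : q^T *m v = (dotp q v)%:M.
    by apply/matrixP => i j; rewrite !ord1 [RHS]mxE.
  by rewrite mul_mx_scalar dotpZr (dotpC v q) -expr2 subrK.
set k := 1 - c ^+ 2.
have k0 : 0 <= k by rewrite subr_ge0 expr_le1// ltW.
pose s := Num.sqrt k.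
have s2 : s ^+ 2 = k by rewrite sqr_sqrtr.
pose g (p : T * R) : \bar R := (expR (dotp a (xi p.1)
    + k / 2 * dotp (xi p.1) (Q' *m xi p.1) + s * p.2 * dotp q (xi p.1)))%:E.
have mg : measurable_fun setT g.
  apply/measurable_EFinP; apply: measurableT_comp => //.
  have mfst (h : T -> R) : measurable_fun setT h ->
      measurable_fun setT (fun p : T * R => h p.1).
    by move=> mh; apply: measurableT_comp.
  apply: measurable_funD; first apply: measurable_funD.
  - exact: (mfst _ (measurable_dotp a)).
  - apply: measurable_funM => //; exact: (mfst _ (measurable_quad Q')).
  - apply: measurable_funM; last exact: (mfst _ (measurable_dotp q)).
    exact: measurable_funM.
have g0 p : (0 <= g p)%E by rewrite lee_fin expR_ge0.
have := @fubini_tonelli _ _ _ _ _ P (normal_prob 0 1) g mg g0.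
rewrite /fubini_F /fubini_G /=.
have -> : (\int[P]_w \int[normal_prob 0 1]_z g (w, z)
    = \int[P]_w (expR (dotp a (xi w) + k / 2 * dotp (xi w) (Q *m xi w)))%:E)%E.
  apply: eq_integral => w _; rewrite /g/=.
  under eq_integral do rewrite expRD EFinM.
  rewrite ge0_integralZl//; last first.
    apply/measurable_EFinP; apply: measurableT_comp => //.
    by apply: measurable_funM => //; exact: measurable_funM.
  under eq_integral do rewrite mulrAC.
  rewrite normal_mgf// -EFinM -expRD; congr (expR _)%:E.
  by rewrite QE expr1n mul1r exprMn s2; field.
move=> ->.
transitivity (\int[normal_prob 0 1]_z
  ((c ^- r * expR ((dotp a a + k / c ^+ 2 * dotp a (Q' *m a)) / 2))%:E
   * (expR (s * dotp a q * z + (1 - c ^+ 2) / (2 * 1 ^+ 2) * z ^+ 2))%:E))%E.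
  apply: eq_integral => z _; rewrite /g /=.
  transitivity (\int[P]_w (expR (dotp (a + (s * z) *: q) (xi w)
                    + (1 - c ^+ 2) / 2 * dotp (xi w) (Q' *m xi w)))%:E)%E.
    apply: eq_integral => w _; congr (expR _)%:E.
    by rewrite !dotp_lin /k; ring.
  rewrite IH// -EFinM; congr (_%:E); rewrite -[RHS]mulrA -expRD.
  congr (_ * expR _).
  rewrite mulmxDr -scalemxAr Q'q scaler0 addr0 !dotp_lin.
  have -> : dotp q (Q' *m a) = 0.
    by rewrite dotp_tr Q's Q'q /dotp trmx0 mul0mx mxE.
  rewrite qq (dotpC q a) mulr0 addr0 -/k -s2.
  by field; rewrite gt_eqF.
rewrite ge0_integralZl//; last 2 first. 
- apply/measurable_EFinP; apply: measurableT_comp => //.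
  apply: measurable_funD; first exact: measurable_funM.
  by apply: measurable_funM => //; exact: exprn_measurable.
- by rewrite lee_fin mulr_ge0 ?expR_ge0// invr_ge0 exprn_ge0// ltW.
rewrite normal_expR_quad// -EFinM QE exprMn s2 (dotpC q a); congr EFin.
rewrite mulrACA -invfM -exprSr -expRD; congr (_ * expR _).
by field; rewrite gt_eqF.
Qed.

(** Chernoff's bound with the optimal exponent.  With u = sqrt r and
    y = sqrt (2 x) it gives (1 + y / u)^r e^(- u y - y^2 / 2), and
    1 + y / u <= e^(y / u) leaves e^(- y^2 / 2). *)
Lemma chi2_tail (r : nat) (Q : 'M[R]_n) (x : R) :
  Q^T = Q -> Q *m Q = Q -> \tr Q = r%:R -> 0 < x ->
  let A := [set w | (Num.sqrt (2 * x) + Num.sqrt r%:R) ^+ 2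
                    < dotp (xi w) (Q *m xi w)] in
  measurable A /\ (P A <= (expR (- x))%:E)%E.
Proof.
move=> Qs QQ trQ x0 A.
have mA : measurable A.
  have -> : A = ~` [set w | dotp (xi w) (Q *m xi w)
                            <= (Num.sqrt (2 * x) + Num.sqrt r%:R) ^+ 2].
    by apply/seteqP; split => w; rewrite /A/= ltNge => /negP.
  apply: measurableC; rewrite -[X in measurable X]setTI.
  by apply: measurable_fun_le => //; exact: measurable_quad.
split=> //; have [r0|r0] := posnP r.
  have -> : A = set0.
    apply/seteqP; split => // w; rewrite /A/= r0 sqrtr0 addr0.
    rewrite (sym_idem_tr0 Qs QQ) ?trQ ?r0// mul0mx dotpE big1 => [|i _].
      by rewrite ltNge sqr_ge0.
    by rewrite mxE mulr0.
  by rewrite measure0 lee_fin expR_ge0.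
pose y := Num.sqrt (2 * x); pose u : R := Num.sqrt r%:R.
have y0 : 0 < y by rewrite sqrtr_gt0 mulr_gt0.
have u0 : 0 < u by rewrite sqrtr_gt0 ltr0n.
have y2 : y ^+ 2 = 2 * x by rewrite sqr_sqrtr// mulr_ge0// ltW.
have u2 : u ^+ 2 = r%:R by rewrite sqr_sqrtr.
(* the optimal Chernoff exponent is (1 - c^2) / 2 for this c *)
pose c := u / (y + u).
have yu0 : 0 < y + u by rewrite addr_gt0.
have c0 : 0 < c by rewrite divr_gt0.
have c1 : c <= 1 by rewrite ler_pdivrMr// mul1r lerDr ltW.
have := quad_mgf Qs QQ trQ c0 c1 0.
have d0 (v : 'cV[R]_n) : dotp 0 v = 0.
  by rewrite dotpE big1// => i _; rewrite mxE mul0r.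
under eq_integral do rewrite d0 add0r.
rewrite !d0 mulr0 addr0 mul0r expR0 mulr1 => mgf.
set k := (1 - c ^+ 2) / 2 in mgf.
have k0 : 0 <= k by rewrite divr_ge0// subr_ge0 expr_le1// ltW.
have mf : measurable_fun setT (fun w => expR (k * dotp (xi w) (Q *m xi w))).
  apply: measurableT_comp => //; apply: measurable_funM => //.
  exact: measurable_quad.
have mgf_le : (\int[P]_w (expR (k * dotp (xi w) (Q *m xi w)))%:E
    <= (c ^- r)%:E)%E by rewrite mgf.
have [mB PB] := markov_ge0 mf (fun w => expR_ge0 _) mgf_le
  (expR_gt0 (k * (y + u) ^+ 2)).
apply: (@le_trans _ _ (P [set w | (expR (k * (y + u) ^+ 2)
    <= expR (k * dotp (xi w) (Q *m xi w)))%R])).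
  apply: le_measure; rewrite ?inE// => w /ltW Aw /=.
  by rewrite ler_expR ler_wpM2l.
apply: (le_trans PB); rewrite lee_fin -expRN -/y -/u.
have cr : c ^- r <= expR (u * y).
  have -> : u * y = r%:R * (y / u).
    by rewrite -u2; field; rewrite gt_eqF.
  rewrite expRM_natl -exprVn lerXn2r ?nnegrE ?expR_ge0 ?invr_ge0 ?(ltW c0)//.
  rewrite /c invf_div mulrDl divff ?gt_eqF// addrC.
  exact: expR_ge1Dx.
have -> : - x = u * y + - (k * (y + u) ^+ 2).
  have -> : k * (y + u) ^+ 2 = u * y + x.
    rewrite /k /c; have -> : x = y ^+ 2 / 2 by rewrite y2; field.
    by field; rewrite gt_eqF.
  by ring.
by rewrite expRD ler_wpM2r// expR_ge0.
Qed.

End GaussianVector.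

(** * Weighted union bound *)

Section WeightedUnionBound.
Context {R : realType}.

(** Under the probability |g_i| / N the mean of sign(g_i) th_i exceeds tau, so
    that Jensen's inequality bounds the mean of e^(nu sign(g_i) th_i) from below;
    the hypothesis on [lam] compares this mean with the weighted sum.  The tangent of the exponential at nu tau stands for
    Jensen's inequality. *)
Lemma exp_weight_lower M (lam th g : 'I_M -> R) (nu tau : R) :
  let N := \sum_i `|g i| in
  0 <= nu -> (forall i, `|g i| <= lam i * N) -> tau * N < \sum_i th i * g i ->
  expR (nu * tau) <= \sum_i lam i * (expR (nu * th i) + expR (- nu * th i)).
Proof.
move=> N nu0 glam viol.
have N0 : 0 < N.
  rewrite lt_neqAle sumr_ge0// andbT; apply: contraPneq viol => N0.
  rewrite -N0 mulr0 big1 ?ltxx// => i _.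
  move/esym/eqP: N0; rewrite psumr_eq0// => /allP/(_ i (mem_index_enum _))/=.
  by rewrite normr_eq0 => /eqP ->; rewrite mulr0.
rewrite -(ler_pM2r N0) mulr_suml.
set e := expR (nu * tau).
apply: (@le_trans _ _ (\sum_i e * (`|g i| + nu * (th i * g i - tau * `|g i|)))).
  rewrite -mulr_sumr big_split/= -mulr_sumr sumrB -mulr_sumr -/N.
  by rewrite ler_wpM2l ?expR_ge0// lerDl mulr_ge0// subr_ge0 ltW.
apply: ler_sum => i _.
have tangent y : e * (1 + (nu * y - nu * tau)) <= expR (nu * y).
  have -> : expR (nu * y) = e * expR (nu * y - nu * tau).
    by rewrite -expRD addrC subrK.
  by rewrite ler_wpM2l ?expR_ge0// expR_ge1Dx.
set E1 := expR (nu * th i); set E2 := expR (- nu * th i).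
have E10 : 0 <= E1 by exact: expR_ge0.
have E20 : 0 <= E2 by exact: expR_ge0.
apply: (@le_trans _ _ (`|g i| * (E1 + E2))); last first.
  by rewrite mulrAC ler_wpM2r// addr_ge0.
have [g0|g0] := leP 0 (g i).
  rewrite (ger0_norm g0).
  have := tangent (th i); rewrite -/E1 => /(ler_wpM2l g0).
  by have := mulr_ge0 g0 E20; lra.
rewrite (ltr0_norm g0).
have := tangent (- th i); rewrite mulrN -mulNr -/E2.
have ng : 0 <= - g i by rewrite oppr_ge0 ltW.
move=> /(ler_wpM2l ng).
by have := mulr_ge0 ng E10; lra.
Qed.

Context {d : measure_display} {T : measurableType d} (P : probability T R).
Variables (n : nat) (xi : T -> 'cV[R]_n).
Hypothesis mxi : forall i, measurable_fun setT (fun w => xi w i 0).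
Hypothesis xi_mgf : forall a : 'cV[R]_n,
  (\int[P]_w (expR (dotp a (xi w)))%:E = (expR (dotp a a / 2))%:E)%E.

(** The exceptional event does not depend on [h]: it is the event that the
    exponential sum with the weights of [exists_sup_weights] is large. *)
Lemma linear_noise_bound M (A : 'M[R]_(M, n)) (B : 'M[R]_(n, M)) (V nu tau : R) :
  (forall i, dotp (col i B) (col i B) <= V) -> 0 <= nu ->
  exists E : set T, [/\ measurable E,
    (P E <= ((\rank A)%:R * (2 * expR (nu ^+ 2 * V / 2)) / expR (nu * tau))%:E)%E &
    forall w, ~ E w -> forall h : 'cV[R]_n,
      dotp (B^T *m xi w) (A *m h) <= tau * norm1 (A *m h)].
Proof.
move=> BV nu0.
have [lam [lam0 sum_lam lamP]] := exists_sup_weights A.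
pose th i w := dotp (col i B) (xi w).
pose f w := \sum_i lam i * (expR (nu * th i w) + expR (- nu * th i w)).
have mexp k i : measurable_fun setT (fun w => expR (k * th i w)).
  apply: measurableT_comp => //; apply: measurable_funM => //.
  exact: measurable_dotp.
have mterm i : measurable_fun setT
    (fun w => lam i * (expR (nu * th i w) + expR (- nu * th i w))).
  by apply: measurable_funM => //; exact: measurable_funD.
have mf : measurable_fun setT f by exact: measurable_sum.
have f0 w : 0 <= f w.
  by apply: sumr_ge0 => i _; rewrite mulr_ge0// addr_ge0// expR_ge0.
have int1 k i : k ^+ 2 = nu ^+ 2 -> (\int[P]_w (expR (k * th i w))%:E
    <= (expR (nu ^+ 2 * V / 2))%:E)%E.
  move=> k2; have := xi_mgf (k *: col i B).
  under eq_integral do rewrite dotpZl.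
  move=> ->; rewrite lee_fin ler_expR !dotp_lin mulrA -expr2 k2.
  by rewrite ler_pM2r// ler_wpM2l// sqr_ge0.
have intf : (\int[P]_w (f w)%:E
    <= ((\rank A)%:R * (2 * expR (nu ^+ 2 * V / 2)))%:E)%E.
  under eq_integral do rewrite -sumEFin.
  rewrite ge0_integral_sum//; last 2 first.
  - by move=> i; exact/measurable_EFinP.
  - by move=> i w _; rewrite lee_fin mulr_ge0// addr_ge0// expR_ge0.
  apply: (@le_trans _ _ (\sum_i (lam i * (2 * expR (nu ^+ 2 * V / 2)))%:E)%E).
    apply: lee_sum => i _; under eq_integral do rewrite EFinM.
    rewrite ge0_integralZl//; last 2 first.
    - by apply/measurable_EFinP; exact: measurable_funD.
    - by rewrite lee_fin.
    rewrite EFinM lee_wpmul2l ?lee_fin//.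
    under eq_integral do rewrite EFinD.
    rewrite ge0_integralD//; last 2 first.
    - exact/measurable_EFinP.
    - exact/measurable_EFinP.
    rewrite mulr_natl mulr2n EFinD; apply: leeD; first exact: int1.
    by apply: int1; rewrite sqrrN.
  rewrite sumEFin lee_fin -mulr_suml ler_wpM2r// mulr_ge0// expR_ge0.
have [mE PE] := markov_ge0 mf f0 intf (expR_gt0 (nu * tau)).
exists [set w | expR (nu * tau) <= f w]; split=> // w /negP; rewrite -ltNge => Ew h.
rewrite leNgt; apply/negP => viol; move: Ew; rewrite ltNge => /negP; apply.
apply: (@exp_weight_lower _ _ _ (fun i => (A *m h) i 0)) => //.
rewrite -[X in tau * X]/(norm1 (A *m h)) (lt_le_trans viol)// dotpE.
suff -> : (B^T *m xi w) = \col_i th i w by apply: ler_sum => i _; rewrite mxE.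
apply/colP => i; rewrite [RHS]mxE.
by rewrite /th /dotp tr_col -row_mul [RHS]mxE.
Qed.

(** [linear_noise_bound] at nu = s2 / tau.  This choice makes nu tau equal to
    [s2] and the exponent nu^2 V / 2 at most s2 / 2, without dividing by [V],
    which may vanish. *)
Lemma range_noise_tail M (A : 'M[R]_(M, n)) (B : 'M[R]_(n, M)) (V t tau : R) :
  let s2 := 2 * ln (2 * (\rank A)%:R) + 2 * t in
  (forall i, dotp (col i B) (col i B) <= V) -> 0 < t -> 0 < tau ->
  V * s2 <= tau ^+ 2 ->
  exists E : set T, [/\ measurable E, (P E <= (expR (- t))%:E)%E &
    forall w, ~ E w -> forall h : 'cV[R]_n,
      dotp (B^T *m xi w) (A *m h) <= tau * norm1 (A *m h)].
Proof.
move=> s2 BV t0 tau0 Vtau.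
(* for rank 0 the bound of [linear_noise_bound] is 0 whatever nu is *)
have [k0|k0] := posnP (\rank A).
  have [E [mE PE EP]] := linear_noise_bound A tau BV (lexx 0).
  exists E; split=> //; apply: (le_trans PE).
  by rewrite k0 !mul0r lee_fin expR_ge0.
have lnk : 0 <= ln (2 * (\rank A)%:R) :> R.
  by rewrite ln_ge0// -natrM ler1n muln_gt0.
have s20 : 0 <= s2 by rewrite /s2; lra.
have nu0 : 0 <= s2 / tau by rewrite divr_ge0// ltW.
have [E [mE PE EP]] := linear_noise_bound A tau BV nu0.
exists E; split=> //; apply: (le_trans PE); rewrite lee_fin.
rewrite divfK ?gt_eqF//.
have expo : (s2 / tau) ^+ 2 * V / 2 <= s2 / 2.
  rewrite ler_pM2r// expr_div_n mulrAC ler_pdivrMr ?exprn_gt0//.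
  by rewrite expr2 -mulrA ler_wpM2l// mulrC.
rewrite -expRN.
apply: (@le_trans _ _ ((2 * (\rank A)%:R) * (expR (s2 / 2) * expR (- s2)))).
  rewrite mulrA (mulrC _ 2) -mulrA ler_wpM2l ?mulr_ge0//.
  by rewrite ler_wpM2r ?expR_ge0// ler_expR.
have k20 : 0 < 2 * (\rank A)%:R :> R by rewrite mulr_gt0// ltr0n.
rewrite -expRD -{1}(lnK (x := 2 * (\rank A)%:R)) ?posrE// -expRD ler_expR.
by rewrite /s2; lra.
Qed.

End WeightedUnionBound.

(** * Measurability of the estimator *)

Section MeasurableLipschitz.
Context {R : realType} {d : measure_display} {T : measurableType d}.

(** The set where [X] exceeds a level is a union of preimages under [Y] of balls
    with rational centers and radii: around each of its points the Lipschitz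
    bound leaves room for such a ball. *)
Lemma measurable_lipschitz n (Y : T -> 'cV[R]_n) (X : T -> R) :
  (forall i, measurable_fun setT (fun w => Y w i 0)) ->
  (forall w w', `|X w - X w'| <= norm1 (Y w - Y w')) ->
  measurable_fun setT X.
Proof.
move=> mY XY _; apply: (measurability _ (RGenOInfty.measurableE R)) => //.
move=> _ [_ [a ->] <-]; rewrite preimage_itvoy setTI.
pose ball (q : {ffun 'I_n -> rat} * rat) : set T :=
  [set w | norm1 (Y w - \col_i ratr (q.1 i)) < ratr q.2].
have mball q : measurable (ball q).
  have -> : ball q = ~` [set w | ratr q.2 <= norm1 (Y w - \col_i ratr (q.1 i))].
    by apply/seteqP; split => w; rewrite /ball/= ltNge => /negP.
  apply: measurableC; rewrite -[X in measurable X]setTI.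
  apply: measurable_fun_le => //; apply: measurable_sum => i.
  apply: measurableT_comp => //.
  under eq_fun do rewrite mxE [X in _ + X]mxE.
  exact: measurable_funD.
have -> : [set w | a < X w] =
    \bigcup_q (if `[< ball q `<=` [set w | a < X w] >] then ball q else set0).
  apply/seteqP; split => [w /= aX|w [q _]]; last by case: asboolP => // + ?; exact.
  have /rat_in_itvoo[r] : 0 < (X w - a) / 2 by rewrite divr_gt0// subr_gt0.
  rewrite inE/= => /itvP r0.
  have rn : 0 < ratr r / n.+1%:R :> R by rewrite divr_gt0// r0.
  have /choice[q qY] (i : 'I_n) :
      exists q : rat, `|Y w i 0 - ratr q| < ratr r / n.+1%:R.
    have /rat_in_itvoo[q] : Y w i 0 - ratr r / n.+1%:R < Y w i 0 + ratr r / n.+1%:R.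
      by rewrite ltrBlDr -addrA ltrDl addr_gt0.
    by rewrite inE/= => /itvP qq; exists q; rewrite distrC ltr_distl !qq.
  have wq : ball ([ffun i => q i], r) w.
    rewrite /ball/= /norm1.
    apply: (@le_lt_trans _ _ (\sum_(i < n) (ratr r / n.+1%:R : R))).
      by apply: ler_sum => i _; rewrite !mxE ffunE ltW.
    rewrite sumr_const card_ord -[ltLHS]mulr_natr -mulrA gtr_pMr ?r0//.
    by rewrite mulrC ltr_pdivrMr// mul1r ltr_nat.
  exists ([ffun i => q i], r) => //; case: asboolP => //; case => w' w'q /=.
  pose v : 'cV[R]_n := \col_i ratr ([ffun i => q i] i).
  have := XY w w'; have := norm1B (Y w - v) (Y w' - v).
  rewrite opprB addrA subrK.
  move: wq w'q; rewrite /ball/= -/v => wq w'q YY XX.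
  have {XX}/ltr_normlP[_ ] : `|X w - X w'| < X w - a.
    have : ratr r < (X w - a) / 2 by rewrite r0.
    by lra.
  by lra.
by apply: countable_bigcupT_measurable => // q; case: ifP.
Qed.

End MeasurableLipschitz.

Section Estimator.
Context {R : realType} {d : measure_display} {T : measurableType d}.
Context {m n : nat} (D : 'M[R]_(m, n)).

Lemma measurable_estimator (Y : T -> 'cV[R]_n) lambda (fhat : T -> 'cV[R]_n) :
  0 <= lambda -> (0 < n)%N ->
  (forall i, measurable_fun setT (fun w => Y w i 0)) ->
  (forall w, is_analysis_estimator D (Y w) lambda (fhat w)) ->
  forall i, measurable_fun setT (fun w => fhat w i 0).
Proof.
move=> l0 n0 mY est i; apply: (measurable_lipschitz mY) => w w'.
have lip := estimator_lipschitz l0 n0 (est w) (est w').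
rewrite -(ler_pXn2r (n := 2))// ?nnegrE ?norm1_ge0//.
apply: (le_trans _ (dotp_le_norm1_sqr _)); apply: (le_trans _ lip).
rewrite dotpE (bigD1 i)//= !mxE real_normK ?num_real// expr2 lerDl.
by apply: sumr_ge0 => j _; rewrite -expr2 sqr_ge0.
Qed.

Lemma measurable_normn_sqr (g : T -> 'cV[R]_n) (f : 'cV[R]_n) :
  (forall i, measurable_fun setT (fun w => g w i 0)) ->
  measurable_fun setT (fun w => normn (g w - f) ^+ 2).
Proof.
move=> mg; under eq_fun do rewrite sqr_normn.
apply: measurable_funM => //; apply: measurable_sum => i.
apply: (measurableT_comp (exprn_measurable 2)).
under eq_fun do rewrite mxE [X in _ + X]mxE.
exact: measurable_funD.
Qed.

Lemma measurable_norm1_mul k (A : 'M[R]_(k, n)) (g : T -> 'cV[R]_n) :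
  (forall i, measurable_fun setT (fun w => g w i 0)) ->
  measurable_fun setT (fun w => norm1 (A *m g w)).
Proof.
move=> mg; apply: measurable_sum => i; apply: measurableT_comp => //.
under eq_fun do rewrite mxE.
by apply: measurable_sum => j; exact: measurable_funM.
Qed.

End Estimator.

(** * Oracle inequality for the analysis estimator *)

Unset Implicit Arguments.

Theorem theorem2p2 (R : realType) (d : measure_display) (T : measurableType d)
    (P : probability T R) (m n : nat) (D : 'M[R]_(m, n))
    (f0 : 'cV[R]_n) (sigma : R) (eps : 'I_n -> {RV P >-> R})
    (S : {set 'I_m}) (x t lambda : R) (fhat : T -> 'cV[R]_n) :
  0 < sigma ->
  iid_normal sigma eps ->
  is_active_set D S ->
  0 < x -> 0 < t -> 0 < lambda ->
  scaling_factor D S * sigma *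
    Num.sqrt (2 * ln (2 * (n%:R - (nulldim D S)%:R)) / n%:R + 2 * t / n%:R)
    <= lambda ->
  (forall w, is_analysis_estimator D (f0 + rvec eps w) lambda (fhat w)) ->
  forall f : 'cV[R]_n,
  ((1 - expR (- x) - expR (- t))%:E <=
   P [set w | (normn (fhat w - f0) ^+ 2
                 + 2 * lambda * norm1 (rows_in D S *m fhat w)
               <= normn (f - f0) ^+ 2
                 + sigma ^+ 2 / n%:R
                   * (Num.sqrt (2 * x) + Num.sqrt (nulldim D S)%:R) ^+ 2
                 + 4 * lambda * norm1 (D *m f))%R])%E.
Proof.
move=> s0 noise _ x0 t0 l0 lge est f.
set G := [set w | _].
(* in dimension 0 all norms vanish, by the convention 0^-1 = 0 *)
have [n0|n0] := posnP n.
  have -> : G = setT.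
    apply/seteqP; split => // w _; rewrite /G/=.
    have -> : rows_in D S *m fhat w = 0.
      apply/colP => i; rewrite !mxE big1// => -[j jn]; exfalso.
      by rewrite n0 ltn0 in jn.
    have nR0 : n%:R = 0 :> R by rewrite n0.
    have v0 (v : 'cV[R]_n) : normn v ^+ 2 = 0 by rewrite sqr_normn nR0 invr0 mulr0.
    have -> : norm1 (0 : 'cV[R]_#|S|) = 0.
      by rewrite /norm1 big1// => i _; rewrite mxE normr0.
    rewrite !v0 mulr0 !add0r addr_ge0//.
    - by rewrite mulr_ge0 ?sqr_ge0// divr_ge0 ?sqr_ge0.
    - by rewrite mulr_ge0 ?norm1_ge0// mulr_ge0// ltW.
  rewrite probability_setT lee_fin.
  by have := expR_ge0 (- x); have := expR_ge0 (- t); lra.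
have nR : 0 < n%:R :> R by rewrite ltr0n.
set A := rows_in D (~: S)%SET.
pose xi w := sigma^-1 *: rvec eps w.
have meps i : measurable_fun setT (fun w => rvec eps w i 0).
  by under eq_fun do rewrite mxE; exact: measurable_funPT.
have mxi i : measurable_fun setT (fun w => xi w i 0).
  by rewrite /xi; under eq_fun do rewrite mxE; exact: measurable_funM.
have xi_mgf a := iid_normal_mgf a s0 noise.
have epsE w : rvec eps w = sigma *: xi w.
  by rewrite /xi scalerA mulfV ?gt_eqF// scale1r.
have mfhat : forall i, measurable_fun setT (fun w => fhat w i 0).
  apply: (measurable_estimator (ltW l0) n0 _ est) => i.
  under eq_fun do rewrite mxE.
  exact: measurable_funD.
have mG : measurable G.
  rewrite -[X in measurable X]setTI; apply: measurable_fun_le => //.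
  apply: measurable_funD; first exact: measurable_normn_sqr.
  by apply: measurable_funM => //; exact: measurable_norm1_mul.
have [mE1 PE1] := chi2_tail mxi xi_mgf (kerproj_sym A) (kerproj_idem A)
  (tr_kerproj A) x0.
set E1 := [set w | _] in mE1 PE1.
have [E2 [mE2 PE2 E2P]] : exists E : set T,
    [/\ measurable E, (P E <= (expR (- t))%:E)%E & forall w, ~ E w -> forall h : 'cV[R]_n,
      dotp ((mpinv A)^T *m xi w) (A *m h) <= n%:R * lambda / sigma * norm1 (A *m h)].
  apply: (@range_noise_tail _ _ _ _ _ _ mxi xi_mgf _ _ _ _ t) => //.
  - by move=> i; exact: col_mpinv_le.
  - by rewrite divr_gt0// mulr_gt0.
  have rk : (\rank A)%:R = n%:R - (nulldim D S)%:R :> R.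
    rewrite /nulldim -/A mxrank_ker mxrank_tr natrB ?rank_leq_col//.
    by rewrite opprB addrC subrK.
  rewrite rk; set s2 := 2 * ln _ + 2 * t.
  set gam := scaling_factor D S in lge *.
  have gam0 : 0 <= gam by rewrite /gam /scaling_factor; exact: bigmax_ge_id.
  move: lge; rewrite -mulrDl -/s2 => lge.
  have [s2n|s2p] := leP s2 0.
    apply: (@le_trans _ _ 0); last by rewrite sqr_ge0.
    by rewrite mulr_ge0_le0// mulr_ge0// sqr_ge0.
  have sq : (gam * sigma) ^+ 2 * (s2 / n%:R) <= lambda ^+ 2.
    rewrite -[s2 / n%:R]sqr_sqrtr ?divr_ge0 ?(ltW s2p) ?(ltW nR)// -exprMn.
    by rewrite lerXn2r ?nnegrE ?mulr_ge0 ?sqrtr_ge0 ?(ltW s0) ?(ltW l0).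
  rewrite expr_div_n ler_pdivlMr ?exprn_gt0// exprMn.
  have -> : n%:R * gam ^+ 2 * s2 * sigma ^+ 2 =
      n%:R ^+ 2 * ((gam * sigma) ^+ 2 * (s2 / n%:R)).
    by field; rewrite gt_eqF.
  by rewrite ler_wpM2l// sqr_ge0.
have GE : ~` G `<=` E1 `|` E2.
  move=> w nG; apply: contrapT => /not_orP[nE1 nE2]; apply: nG.
  rewrite /G/= [_ / n%:R * _]mulrAC.
  have := oracle_inequality f n0 l0 (est w); apply.
    have -> : dotp (rvec eps w) (kerproj A *m rvec eps w)
        = sigma ^+ 2 * dotp (xi w) (kerproj A *m xi w).
      rewrite epsE; move: (xi w) => v.
      by rewrite -scalemxAr !dotp_lin mulrA expr2.
    rewrite ler_wpM2l ?sqr_ge0//.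
    by move/negP: nE1; rewrite -leNgt.
  move=> h; rewrite epsE -scalemxAr dotpZl -ler_pdivlMl//.
  by rewrite (le_trans (E2P w nE2 h))// mulrA (mulrC sigma^-1).
have PG : (P (~` G) <= (expR (- x) + expR (- t))%:E)%E.
  apply: (@le_trans _ _ (P (E1 `|` E2))).
    by apply: le_measure; rewrite ?inE//; [exact: measurableC|exact: measurableU].
  by rewrite (le_trans (measureU2 P mE1 mE2))// EFinD leeD.
rewrite -[G]setCK probability_setC; last exact: measurableC.
by rewrite -addrA -opprD EFinB leeB.
Qed.
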